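(* Let $D$ be a diagram in the plane with $n$ boxes (with a fixed reading order) and let $\mathrm{StdTab}(D)$ be an ascent-compatible subset of $\mathrm{StdFill}(D)$. Then $$ch([\mathbf{N}_{\mathrm{StdTab}(D)}])=\sum_{T\in \mathrm{StdTab}(D)}F_{\mathrm{comp}_n(\mathrm{Des}(T))}.$$
   Context: Compositions. A composition $\alpha=(\alpha_1,\dots,\alpha_k)\vDash n$ is a sequence of positive integers with sum $n$; $\mathrm{Des}(\alpha)=\{\alpha_1,\alpha_1+\alpha_2,\dots,\alpha_1+\cdots+\alpha_{k-1}\}\subseteq [n-1]=\{1,\dots,n-1\}$. This is a bijection from compositions of $n$ to subsets of $[n-1]$; $\mathrm{comp}_n(X)$ is the composition of $n$ with descent set $X$. The fundamental quasisymmetric function is $F_\alpha=\sum x_{i_1}\cdots x_{i_n}$ over positive integers $i_1\le\cdots\le i_n$ with $i_j<i_{j+1}$ whenever $j\in\mathrm{Des}(\alpha)$; these form a basis of the algebra $\mathsf{QSym}$ of quasisymmetric functions. $H_n(0)$ is the $\mathbb{C}$-algebra with generators $\pi_1,\dots,\pi_{n-1}$ and relations $\pi_i^2=-\pi_i$, $\pi_i\pi_j=\pi_j\pi_i$ for $|i-j|\ge2$, $\pi_i\pi_{i+1}\pi_i=\pi_{i+1}\pi_i\pi_{i+1}$. Its simple modules are $\mathbf{F}_\alpha=\mathbb{C}v_\alpha$, $\alpha\vDash n$, with $\pi_iv_\alpha=-v_\alpha$ if $i\in\mathrm{Des}(\alpha)$ and $0$ otherwise. The quasisymmetric characteristic $ch$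 is the isomorphism of Duchamp, Krob, Leclerc and Thibon from $\bigoplus_n\mathcal{G}_0(H_n(0))$ (Grothendieck groups of finite-dimensional modules) to $\mathsf{QSym}$ with $ch([\mathbf{F}_\alpha])=F_\alpha$. Diagram modules. $\mathrm{StdFill}(D)$ is the set of bijective assignments of $1,\dots,n$ to the boxes of $D$. A reading order is a total order on the boxes; $\mathrm{rw}(T)$ is the permutation given by the entries of $T$ in reading order from left to right. $s_iT$ exchanges the entries $i,i+1$ of $T$. For a nonempty $\mathrm{StdTab}(D)\subseteq\mathrm{StdFill}(D)$ and $T\in\mathrm{StdTab}(D)$, $\mathrm{Des}(T)$ is the set of $i\in[n-1]$ with $i$ to the right of $i+1$ in $\mathrm{rw}(T)$. Elements of $[n-1]\setminus\mathrm{Des}(T)$ are ascents; an ascent $i$ is attacking if $s_iT\notin\mathrm{StdTab}(D)$ and nonattacking otherwise. $T$ has an ascent in positions $(r,s)$ if $r<s$ and $\mathrm{rw}(T)_s-\mathrm{rw}(T)_r=1$. $\mathrm{StdTab}(D)$ is ascent-compatible if whenever $T,T'\in\mathrm{StdTab}(D)$ both have an ascent in positions $(r,s)$, it is attacking in $T$ if and only if it is attacking in $T'$. In that case $\mathbf{N}_{\mathrm{StdTab}(D)}$ is the $H_n(0)$-module on the $\mathbb{C}$-span of $\mathrm{StdTab}(D)$ with $\pi_iT=-T$ if $i\in\mathrm{Des}(T)$, $0$ if $i$ is an attacking ascent, $s_iT$ if $i$ is a nonattacking ascent. *)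

(* Defs.v *)
From HB Require Import structures.
From mathcomp Require Import all_boot all_order all_algebra.
From mathcomp Require Import zify fingroup perm finmap monalg.
From mathcomp Require Import boolp classical_sets functions cardinality.

Set Implicit Arguments.
Unset Strict Implicit.
Unset Printing Implicit Defensive.

Import GRing.Theory.
Local Open Scope ring_scope.
Local Open Scope quotient_scope.

(* Everything is indexed from 0: the entries 1, ..., n of a filling are the   *)
(* elements of 'I_n, the set [n-1] is 'I_n.-1 (i : 'I_n.-1 stands for i+1),   *)
(* and the variables x_1, x_2, ... are indexed by nat.                        *)

Section Indices.
Variable n : nat.
Implicit Type i : 'I_n.-1.

Definition idx i : 'I_n := widen_ord (leq_pred n) i.

Fact idxS_proof i : (i.+1 < n)%N.
Proof. by case: n i => [|m] [i]. Qed.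

Definition idxS i : 'I_n := Ordinal (idxS_proof i).

End Indices.

Record composition (n : nat) := Composition {
  parts :> seq nat;
  _ : (0%N \notin parts) && (sumn parts == n) }.

(* The last partial sum, n, is not the successor of an element of 'I_n.-1.    *)
Definition comp_Des n (al : composition n) : {set 'I_n.-1} :=
  [set i : 'I_n.-1 | i.+1 \in scanl addn 0 al].

Section CompOfSet.
Variables (n : nat) (X : {set 'I_n.-1}).

(* Successive differences of 0 < x_1 < ... < x_k < n, for X = {x_1,...,x_k}.  *)
Definition comp_seq : seq nat :=
  if n == 0 then [::]
  else pairmap (fun a b => b - a)%N 0 (rcons [seq i.+1 | i : 'I_n.-1 in X] n).

Let bounds := rcons [seq (i : 'I_n.-1).+1 | i in X] n.

Fact bounds_path : (0 < n)%N -> path ltn 0 bounds.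
Proof.
move=> n0; rewrite /bounds rcons_path.
have E : [seq (i : 'I_n.-1).+1 | i in X] = map succn (map val (enum X)).
  by rewrite /image_mem -map_comp.
have srt : sorted ltn (map val (enum X)).
  rewrite /enum_mem -enumT /= -(eq_filter (a1 := [in X])) //.
  apply: (subseq_sorted ltn_trans (s2 := map val (enum 'I_n.-1))).
    exact/map_subseq/filter_subseq.
  by rewrite val_enum_ord iota_ltn_sorted.
rewrite E; apply/andP; split.
  have : sorted ltn (map succn (map val (enum X))).
    by rewrite sorted_map; apply: sub_sorted srt => a b; rewrite /= ltnS.
  by case: (map val _).
have : all (ltn^~ n) (0 :: map succn (map val (enum X)))%N.
  rewrite /= n0; apply/allP=> _ /mapP[_ /mapP[i _ ->] ->] /=.
  exact: idxS_proof.
by move/allP; apply; exact: mem_last.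
Qed.

Fact comp_seq_proof : (0%N \notin comp_seq) && (sumn comp_seq == n).
Proof.
rewrite /comp_seq; case: eqP => [->//|/eqP]; rewrite -lt0n => n0.
have := bounds_path n0; rewrite -/bounds.
have lastb : last 0%N bounds = n by rewrite last_rcons.
have gen a s : path ltn a s -> (0%N \notin pairmap (fun a b => b - a)%N a s) &&
    (a + sumn (pairmap (fun a b => b - a)%N a s) == last a s)%N.
  elim: s a => [|b s IH] a /=; first by rewrite addn0 eqxx.
  case/andP=> ab /IH /andP[h1 /eqP h2]; rewrite inE negb_or h1 andbT.
  by rewrite eq_sym -lt0n subn_gt0 ab /= addnA subnKC ?h2 // ltnW.
by move=> /gen; rewrite lastb add0n.
Qed.

Definition comp_of_set : composition n := Composition comp_seq_proof.

Lemma comp_of_setK : comp_Des comp_of_set = X.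
Proof.
apply/setP=> i; rewrite inE /= /comp_seq.
have n0 : (0 < n)%N by exact: leq_ltn_trans (leq0n _) (idxS_proof i).
rewrite eqn0Ngt n0 /= -/bounds.
have gen a s : path ltn a s ->
    scanl addn a (pairmap (fun a b => b - a)%N a s) = s.
  elim: s a => [//|b s IH] a /= /andP[ab /IH IHb].
  by rewrite (subnKC (ltnW ab)) IHb.
rewrite (gen _ _ (bounds_path n0)) /bounds mem_rcons inE.
rewrite ltn_eqF ?idxS_proof //=; apply/mapP/idP => [[j]|Xi].
  by rewrite mem_enum => Xj [] /val_inj ->.
by exists i; rewrite ?mem_enum.
Qed.

End CompOfSet.

(* Formal power series in x_0, x_1, ... with integer coefficients.            *)
Definition series : Type := {cmonom nat} -> int.
HB.instance Definition _ := GRing.Zmodule.on series.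

(* x_(s_1) ... x_(s_k)                                                        *)
Definition xmon (s : seq nat) : {cmonom nat} := \big[mmul/mone]_(i <- s) ucm i.

(* x_(i_1)^(a_1) ... x_(i_k)^(a_k)                                            *)
Definition xpow (i a : seq nat) : {cmonom nat} :=
  \big[mmul/mone]_(p <- zip i a) expcmn (ucm p.1) p.2.

Definition quasisymmetric (f : series) : Prop :=
  (exists d, forall m, f m != 0 -> (mdeg m <= d)%N) /\
  (forall i j a : seq nat, size i = size a -> size j = size a ->
     0%N \notin a -> sorted ltn i -> sorted ltn j ->
     f (xpow i a) = f (xpow j a)).

Definition qsym_pred : {pred series} := fun f => `[< quasisymmetric f >].

Lemma qsymP f : reflect (quasisymmetric f) (f \in qsym_pred).
Proof. exact: asboolP. Qed.

Fact qsym_closed : zmod_closed qsym_pred.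
Proof.
split=> [|f g].
  by apply/qsymP; split=> //; exists 0%N => m /eqP[].
move=> /qsymP[[d fd] fq] /qsymP[[e ge] gq]; apply/qsymP; split.
  exists (maxn d e) => m; apply: contraNT; rewrite -ltnNge gtn_max => /andP[dm em].
  rewrite /GRing.add /GRing.opp /= /GRing.opp /=.
  have -> : f m = 0 by apply/eqP; apply: contraTT dm => /fd; rewrite -leqNgt.
  by have -> : g m = 0 by apply/eqP; apply: contraTT em => /ge; rewrite -leqNgt.
move=> i j a *; rewrite /GRing.add /GRing.opp /= /GRing.opp /=.
by rewrite (fq i j) // (gq i j).
Qed.
HB.instance Definition _ := GRing.isZmodClosed.Build series qsym_pred qsym_closed.

Record QSym := MkQSym { qsym_val :> series; _ : qsym_val \in qsym_pred }.
HB.instance Definition _ := [isSub for qsym_val].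
HB.instance Definition _ := [Choice of QSym by <:].
HB.instance Definition _ := [SubChoice_isSubZmodule of QSym by <:].

Section Fundamental.
Variables (n : nat) (al : composition n).

(* i_1 <= ... <= i_n, with i_j < i_(j+1) whenever j is in Des(al)             *)
Definition F_index (s : n.-tuple nat) : bool :=
  [forall j : 'I_n.-1, (tnth s (idx j) <= tnth s (idxS j))%N &&
     ((j \in comp_Des al) ==> (tnth s (idx j) < tnth s (idxS j))%N)].

(* The coefficient of a monomial m in the sum of the x_(i_1) ... x_(i_n).     *)
Definition F_series : series := fun m =>
  (#|` fset_set [set s : n.-tuple nat | F_index s /\ xmon s = m]%classic |)%:Z.

End Fundamental.

Lemma xmonE s x : xmon s x = count_mem x s.
Proof.
rewrite /xmon; elim: s => [|y s IH]; first by rewrite big_nil cm1.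
by rewrite big_cons cmM IH cmU.
Qed.

Lemma xpowE i a x : uniq i -> size i = size a -> xpow i a x = nth 0%N a (index x i).
Proof.
rewrite /xpow; elim: i a => [|y i IH] [|b a] //=; first by rewrite big_nil cm1.
case/andP=> yi ui [sz]; rewrite big_cons cmM IH //=.
have -> : expcmn (ucm y) b x = ((y == x) * b)%N.
  rewrite /expcmn; case: b => [|b]; first by rewrite cm1 muln0.
  rewrite iteropS; elim: b => [|b IHb]; first by rewrite muln1 cmU.
  by rewrite iterS cmM cmU IHb -mulnS.
case: (y =P x) => [<-|_]; last by rewrite mul0n.
by rewrite mul1n nth_default ?addn0 // -sz leqNgt index_mem.
Qed.

Section FundamentalTheory.
Variables (n : nat) (al : composition n).

Lemma F_index_sorted (s : n.-tuple nat) : F_index al s -> sorted leq s.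
Proof.
move=> /forallP Fs; apply/(sortedP 0%N) => k; rewrite size_tuple => kn.
have kn' : (k < n.-1)%N by case: (n) kn.
by have /andP[+ _] := Fs (Ordinal kn'); rewrite !(tnth_nth 0%N).
Qed.

Lemma F_index_inj (s t : n.-tuple nat) :
  F_index al s -> F_index al t -> xmon s = xmon t -> s = t.
Proof.
move=> /F_index_sorted ss /F_index_sorted st e; apply: val_inj => /=.
apply: (sorted_eq leq_trans anti_leq) => //; apply/allP => x _ /=.
by rewrite -!xmonE e.
Qed.

Lemma F_seriesE m : F_series al m =
  (`[< exists s : n.-tuple nat, F_index al s /\ xmon s = m >] : nat)%:Z.
Proof.
rewrite /F_series; congr _%:Z; case: asboolP => [[s [Fs <-]]|nex].
  rewrite (_ : [set _ | _]%classic = [set s]%classic) ?fset_set1 ?cardfs1 //.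
  apply/seteqP; split=> [t [Ft e]|t ->]; last by [].
  exact: F_index_inj.
rewrite (_ : [set _ | _]%classic = set0) ?fset_set0 ?cardfs0 //.
by apply/seteqP; split=> // t Ft; case: nex; exists t.
Qed.

Fact F_index_transfer (s : n.-tuple nat) i j a :
  size i = size a -> size j = size a -> sorted ltn i -> sorted ltn j ->
  F_index al s -> xmon s = xpow i a ->
  exists t : n.-tuple nat, F_index al t /\ xmon t = xpow j a.
Proof.
move=> si sj oi oj Fs es.
have ui : uniq i by apply: sorted_uniq oi; [exact: ltn_trans | exact: ltnn].
have uj : uniq j by apply: sorted_uniq oj; [exact: ltn_trans | exact: ltnn].
have sub x : x \in s -> x \in i.
  move=> xs; have: (0 < xmon s x)%N by rewrite xmonE -has_count has_pred1.
  rewrite es xpowE // -index_mem si.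
  by apply: contraTT; rewrite -leqNgt => ?; rewrite nth_default.
pose phi x := nth 0%N j (index x i).
have phi_lt x y : x \in i -> y \in i -> (x < y)%N -> (phi x < phi y)%N.
  move=> xi yi xy; apply: (sorted_ltn_nth ltn_trans) => //;
    rewrite ?inE ?sj -?si ?index_mem //.
  rewrite ltnNge; apply: contraTN xy; rewrite -leqNgt leq_eqVlt.
  case/orP=> [/eqP e|/(sorted_ltn_index ltn_trans oi) h].
    by rewrite -(nth_index 0%N xi) -(nth_index 0%N yi) e.
  by rewrite ltnW ?h.
have phi_inj : {in i &, injective phi}.
  move=> x y xi yi e; case: (ltngtP x y) => // h.
    by have := phi_lt _ _ xi yi h; rewrite e ltnn.
  by have := phi_lt _ _ yi xi h; rewrite e ltnn.
have inS k : tnth s k \in i by apply: sub; exact: mem_tnth.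
exists (map_tuple phi s); split.
  apply/forallP=> k; have /forallP/(_ k)/andP[le lt] := Fs.
  rewrite !tnth_map; apply/andP; split.
    move: le; rewrite leq_eqVlt => /orP[/eqP-> //|h].
    by rewrite ltnW ?phi_lt.
  by apply/implyP=> kD; apply: phi_lt => //; exact: (implyP lt).
apply/eqP/cmP=> y; rewrite xmonE xpowE // count_map.
have [yj|yj] := boolP (y \in j); last first.
  rewrite nth_default; last by rewrite -sj leqNgt index_mem.
  apply/eqP; rewrite -leqn0 leqNgt -has_count; apply/hasPn => x /sub xi /=.
  by apply: contraNneq yj => <-; rewrite mem_nth // sj -si index_mem.
pose x := nth 0%N i (index y j).
have ly : (index y j < size i)%N by rewrite si -sj index_mem.
have xi : x \in i by rewrite mem_nth.
have px : phi x = y by rewrite /phi index_uniq // nth_index.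
rewrite -[index y j](index_uniq 0%N ly ui) -/x -xpowE // -es xmonE.
apply: eq_in_count => z /sub zi /=; rewrite -px.
by apply/eqP/eqP => [|->//]; exact: phi_inj.
Qed.

Fact F_quasisymmetric : F_series al \in qsym_pred.
Proof.
apply/qsymP; split.
  exists n => m; rewrite F_seriesE; case: asboolP => // -[s [_ <-]] _.
  rewrite /xmon mdeg_prod (eq_bigr (fun=> 1%N)) => [|k _]; last exact: mdegU.
  by rewrite sum1_size size_tuple.
move=> i j a si sj _ oi oj; rewrite !F_seriesE; congr (nat_of_bool _)%:Z.
by apply/asboolP/asboolP => -[s [Fs es]]; exact: F_index_transfer Fs es.
Qed.

Definition QSymF : QSym := MkQSym F_quasisymmetric.

End FundamentalTheory.

Inductive ideal_gen (A : pzRingType) (S : A -> Prop) : A -> Prop :=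
| IdealGen0 : ideal_gen S 0
| IdealGenB x y : ideal_gen S x -> ideal_gen S y -> ideal_gen S (x - y)
| IdealGenM a s b : S s -> ideal_gen S (a * s * b).

Lemma malg_scaleAr (M : monomType) (R : comNzRingType) (c : R)
  (x y : {malg R[M]}) : c *: (x * y) = x * (c *: y).
Proof.
apply/malgP=> k; rewrite mcoeffZ mcoeffMl mulr_sumr.
rewrite (mcoeffMlw _ (fsubset_refl _) (msuppZ_le c y)).
apply: eq_bigr => u _; rewrite mulr_sumr; apply: eq_bigr => v _.
by rewrite mcoeffZ mulrnAr mulrCA.
Qed.

Section Hecke.
Variables (K : fieldType) (n : nat).

(* The free algebra on generators indexed by 'I_n.-1.                         *)
Definition freealg : Type := {malg K[{fmonom 'I_n.-1}]}.
HB.instance Definition _ := GRing.Lalgebra.on freealg.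

Definition fgen (i : 'I_n.-1) : freealg := mkmalgU (fmu i) 1.

Inductive hecke_rel : freealg -> Prop :=
| HeckeQuad i : hecke_rel (fgen i * fgen i + fgen i)
| HeckeComm (i j : 'I_n.-1) : (i.+1 < j)%N || (j.+1 < i)%N ->
    hecke_rel (fgen i * fgen j - fgen j * fgen i)
| HeckeBraid (i j : 'I_n.-1) : j = i.+1 :> nat ->
    hecke_rel (fgen i * fgen j * fgen i - fgen j * fgen i * fgen j).

Definition hecke_ideal : {pred freealg} := fun x => `[< ideal_gen hecke_rel x >].

Lemma hecke_idealP x : reflect (ideal_gen hecke_rel x) (x \in hecke_ideal).
Proof. exact: asboolP. Qed.

Fact hecke_ideal_closed : zmod_closed hecke_ideal.
Proof.
split=> [|x y /hecke_idealP Ix /hecke_idealP Iy]; apply/hecke_idealP.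
  exact: IdealGen0.
exact: IdealGenB.
Qed.
HB.instance Definition _ :=
  GRing.isZmodClosed.Build freealg hecke_ideal hecke_ideal_closed.

Lemma hecke_idealM a x b : x \in hecke_ideal -> a * x * b \in hecke_ideal.
Proof.
move=> /hecke_idealP; elim=> [|y z _ Iy _ Iz|c s d Ss].
- by rewrite mulr0 mul0r rpred0.
- rewrite mulrBr.
  rewrite mulrBl.
  apply: rpredB.
  exact: Iy.
  exact: Iz.
by apply/hecke_idealP; rewrite !mulrA -mulrA; exact: IdealGenM.
Qed.

Lemma hecke_idealZ c x : x \in hecke_ideal -> c *: x \in hecke_ideal.
Proof.
by move=> Ix; rewrite -[x]mul1r scalerAl -[_ * x]mulr1; exact: hecke_idealM.
Qed.

Definition hecke : Type := Quotient.quot hecke_ideal.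
HB.instance Definition _ := GRing.Zmodule.on hecke.

Definition hecke_pi : freealg -> hecke := \pi_(Quotient.quot hecke_ideal).
Definition hecke_repr (h : hecke) : freealg := generic_quotient.repr h.

Lemma hecke_reprK : cancel hecke_repr hecke_pi.
Proof. exact: reprK. Qed.

Lemma hecke_piP x y : (hecke_pi x = hecke_pi y) <-> (x - y \in hecke_ideal).
Proof. by rewrite Quotient.idealrBE; split=> [/eqP|/eqP]. Qed.

Lemma hecke_piD x y : hecke_pi (x + y) = hecke_pi x + hecke_pi y.
Proof. by rewrite /hecke_pi !piE. Qed.

Lemma hecke_pi0 : hecke_pi 0 = 0.
Proof. by rewrite /hecke_pi !piE. Qed.

Definition hecke_one : hecke := hecke_pi 1.
Definition hecke_mul (x y : hecke) : hecke :=
  hecke_pi (hecke_repr x * hecke_repr y).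
Definition hecke_scale (c : K) (x : hecke) : hecke :=
  hecke_pi (c *: hecke_repr x).

Lemma hecke_piM x y : hecke_pi (x * y) = hecke_mul (hecke_pi x) (hecke_pi y).
Proof.
apply/hecke_piP.
have /hecke_piP hx : hecke_pi x = hecke_pi (hecke_repr (hecke_pi x)).
  by rewrite hecke_reprK.
have /hecke_piP hy : hecke_pi y = hecke_pi (hecke_repr (hecke_pi y)).
  by rewrite hecke_reprK.
set x' := hecke_repr (hecke_pi x); set y' := hecke_repr (hecke_pi y).
have -> : x * y - x' * y' = 1 * (x - x') * y + x' * (y - y') * 1.
  by rewrite mul1r mulr1 mulrBl mulrBr addrA subrK.
by rewrite rpredD ?hecke_idealM.
Qed.

Lemma hecke_piZ c x : hecke_pi (c *: x) = hecke_scale c (hecke_pi x).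
Proof.
apply/hecke_piP; rewrite -scalerBr; apply: hecke_idealZ.
by apply/hecke_piP; rewrite hecke_reprK.
Qed.

Fact hecke_mulA : associative hecke_mul.
Proof.
move=> x y z; rewrite -[x]hecke_reprK -[y]hecke_reprK -[z]hecke_reprK.
by rewrite -!hecke_piM mulrA.
Qed.

Fact hecke_mul1r : left_id hecke_one hecke_mul.
Proof. by move=> x; rewrite -[x]hecke_reprK -hecke_piM mul1r. Qed.

Fact hecke_mulr1 : right_id hecke_one hecke_mul.
Proof. by move=> x; rewrite -[x]hecke_reprK -hecke_piM mulr1. Qed.

Fact hecke_mulDl : left_distributive hecke_mul +%R.
Proof.
move=> x y z; rewrite -[x]hecke_reprK -[y]hecke_reprK -[z]hecke_reprK.
by rewrite -hecke_piD -!hecke_piM -hecke_piD mulrDl.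
Qed.

Fact hecke_mulDr : right_distributive hecke_mul +%R.
Proof.
move=> x y z; rewrite -[x]hecke_reprK -[y]hecke_reprK -[z]hecke_reprK.
by rewrite -hecke_piD -!hecke_piM -hecke_piD mulrDr.
Qed.

(* The relations have no constant term.                                       *)
Fact hecke_one_neq0 : hecke_one != 0.
Proof.
apply/eqP; rewrite -hecke_pi0 => /hecke_piP; rewrite subr0 => /hecke_idealP.
pose e : freealg -> K := mcoeff mone.
have eM x y : e (x * y) = e x * e y by exact: rmorphM.
have eB x y : e (x - y) = e x - e y by exact: raddfB.
have eD x y : e (x + y) = e x + e y by exact: raddfD.
have eg i : e (fgen i) = 0.
  rewrite /e /fgen mcoeffU; case: eqP => // /(congr1 (@fmonom_val _)).
  by rewrite fmuE fm1.
have emg x i : e (x * fgen i) = 0 by rewrite eM eg mulr0.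
have: e 1 != 0 by rewrite /e mcoeff1 eqxx oner_eq0.
move=> /eqP e1 I1; apply: e1; elim: I1 => [|x y _ hx _ hy|a s b Ss].
- exact: raddf0.
- by rewrite eB hx hy subr0.
suff es : e s = 0 by rewrite !eM es mulr0 mul0r.
case: Ss => [i|i j _|i j _].
- by rewrite eD eg emg addr0.
- by rewrite eB [X in X - _]emg [X in _ - X]emg subr0.
by rewrite eB [X in X - _]emg [X in _ - X]emg subr0.
Qed.

HB.instance Definition _ := GRing.Zmodule_isNzRing.Build hecke
  hecke_mulA hecke_mul1r hecke_mulr1 hecke_mulDl hecke_mulDr hecke_one_neq0.

Fact hecke_scaleA a b x :
  hecke_scale a (hecke_scale b x) = hecke_scale (a * b) x.
Proof. by rewrite -[x]hecke_reprK -!hecke_piZ scalerA. Qed.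

Fact hecke_scale1 : left_id 1 hecke_scale.
Proof. by move=> x; rewrite -[x]hecke_reprK -hecke_piZ scale1r. Qed.

Fact hecke_scaleDr : right_distributive hecke_scale +%R.
Proof.
move=> c x y; rewrite -[x]hecke_reprK -[y]hecke_reprK.
by rewrite -hecke_piD -!hecke_piZ -hecke_piD scalerDr.
Qed.

Fact hecke_scaleDl x : {morph hecke_scale^~ x : a b / a + b}.
Proof.
by move=> a b; rewrite -[x]hecke_reprK -!hecke_piZ -hecke_piD scalerDl.
Qed.

HB.instance Definition _ := GRing.Zmodule_isLmodule.Build K hecke
  hecke_scaleA hecke_scale1 hecke_scaleDr hecke_scaleDl.

Fact hecke_scaleAl (c : K) (x y : hecke) : c *: (x * y) = c *: x * y.
Proof.
rewrite -[x]hecke_reprK -[y]hecke_reprK /GRing.scale /GRing.mul /=.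
by rewrite -!(hecke_piM, hecke_piZ) scalerAl.
Qed.

HB.instance Definition _ := GRing.Lmodule_isLalgebra.Build K hecke hecke_scaleAl.

Fact hecke_scaleAr (c : K) (x y : hecke) : c *: (x * y) = x * (c *: y).
Proof.
rewrite -[x]hecke_reprK -[y]hecke_reprK /GRing.scale /GRing.mul /=.
by rewrite -!(hecke_piM, hecke_piZ) malg_scaleAr.
Qed.

HB.instance Definition _ := GRing.Lalgebra_isAlgebra.Build K hecke hecke_scaleAr.

Lemma hecke_pi_mul x y : hecke_pi (x * y) = hecke_pi x * hecke_pi y.
Proof. exact: hecke_piM. Qed.

Definition hecke_gen (i : 'I_n.-1) : hecke := hecke_pi (fgen i).

Lemma hecke_gen_quad i : hecke_gen i ^+ 2 = - hecke_gen i.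
Proof.
apply/eqP; rewrite -addr_eq0; apply/eqP; rewrite expr2 /hecke_gen.
rewrite -hecke_pi_mul -hecke_piD -hecke_pi0; apply/hecke_piP.
rewrite subr0; apply/hecke_idealP; rewrite -[X in ideal_gen _ X]mulr1 -[X in X * 1]mul1r.
exact/IdealGenM/HeckeQuad.
Qed.

Lemma hecke_gen_comm (i j : 'I_n.-1) : (i.+1 < j)%N || (j.+1 < i)%N ->
  hecke_gen i * hecke_gen j = hecke_gen j * hecke_gen i.
Proof.
move=> ij; rewrite /hecke_gen -[LHS]hecke_pi_mul -[RHS]hecke_pi_mul.
apply/hecke_piP/hecke_idealP; rewrite -[X in ideal_gen _ X]mulr1 -[X in X * 1]mul1r.
exact/IdealGenM/HeckeComm.
Qed.

Lemma hecke_gen_braid (i j : 'I_n.-1) : j = i.+1 :> nat ->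
  hecke_gen i * hecke_gen j * hecke_gen i
  = hecke_gen j * hecke_gen i * hecke_gen j.
Proof.
move=> ij; have M3 x y z : hecke_pi x * hecke_pi y * hecke_pi z = hecke_pi (x * y * z).
  by rewrite !hecke_pi_mul.
rewrite /hecke_gen [LHS]M3 [RHS]M3.
apply/hecke_piP/hecke_idealP; rewrite -[X in ideal_gen _ X]mulr1 -[X in X * 1]mul1r.
exact/IdealGenM/HeckeBraid.
Qed.

End Hecke.

(* A module structure on the space of column vectors of size fd_dim, given as *)
(* an algebra morphism from H_n(0) to matrices.                               *)
Record fdmod (K : fieldType) (n : nat) := FDMod {
  fd_dim : nat;
  fd_act : hecke K n -> 'M[K]_fd_dim;
  fd_act1 : fd_act 1 = 1%:M;
  fd_actM : forall x y, fd_act (x * y) = fd_act x *m fd_act y;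
  fd_actP : forall c x y, fd_act (c *: x + y) = c *: fd_act x + fd_act y }.

HB.instance Definition _ (K : fieldType) (n : nat) := gen_eqMixin (fdmod K n).
HB.instance Definition _ (K : fieldType) (n : nat) := gen_choiceMixin (fdmod K n).

Section ModuleVectors.
Variables (K : fieldType) (n : nat) (M : fdmod K n).

Definition fdvec : Type := 'cV[K]_(fd_dim M).
HB.instance Definition _ := GRing.Zmodule.on fdvec.

Definition fd_scale (h : hecke K n) (v : fdvec) : fdvec := fd_act M h *m v.

Fact fd_actD x y : fd_act M (x + y) = fd_act M x + fd_act M y.
Proof. by rewrite -[x in LHS]scale1r fd_actP scale1r. Qed.

Fact fd_scaleA a b v : fd_scale a (fd_scale b v) = fd_scale (a * b) v.
Proof. by rewrite /fd_scale mulmxA -fd_actM. Qed.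
Fact fd_scale1 : left_id 1 fd_scale.
Proof. by move=> v; rewrite /fd_scale fd_act1 mul1mx. Qed.
Fact fd_scaleDr : right_distributive fd_scale +%R.
Proof. by move=> a u v; rewrite /fd_scale [LHS]mulmxDr. Qed.
Fact fd_scaleDl v : {morph fd_scale^~ v : a b / a + b}.
Proof. by move=> a b; rewrite /fd_scale fd_actD [LHS]mulmxDl. Qed.

HB.instance Definition _ := GRing.Zmodule_isLmodule.Build (hecke K n) fdvec
  fd_scaleA fd_scale1 fd_scaleDr fd_scaleDl.

End ModuleVectors.

(* Operators satisfying the defining relations make a module.                 *)
Record hecke_ops (K : fieldType) (n d : nat) := HeckeOps {
  ops :> 'I_n.-1 -> 'M[K]_d;
  ops_quad : forall i, ops i *m ops i = - ops i;
  ops_comm : forall i j : 'I_n.-1, (i.+1 < j)%N || (j.+1 < i)%N ->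
    ops i *m ops j = ops j *m ops i;
  ops_braid : forall i j : 'I_n.-1, j = i.+1 :> nat ->
    ops i *m ops j *m ops i = ops j *m ops i *m ops j }.

Section ModuleOfOps.
Variables (K : fieldType) (n d : nat) (p : hecke_ops K n d).

Definition word_act (w : seq 'I_n.-1) : 'M[K]_d :=
  foldr (fun i A => p i *m A) 1%:M w.

Definition free_act (a : freealg K n) : 'M[K]_d :=
  \sum_(w <- msupp a) mcoeff w a *: word_act w.

Fact word_act_cat u v : word_act (u ++ v) = word_act u *m word_act v.
Proof. by elim: u => [|i u IH] /=; rewrite ?mul1mx // IH mulmxA. Qed.

Fact free_actEw (D : {fset {fmonom 'I_n.-1}}) (a : {malg K[{fmonom 'I_n.-1}]}) :
  (msupp a `<=` D)%fset -> free_act a = \sum_(w <- D) mcoeff w a *: word_act w.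
Proof.
move=> le; rewrite /free_act (big_fset_incl _ le) // => w _ /mcoeff_outdom ->.
by rewrite scale0r.
Qed.

Fact free_actP (c : K) (a b : {malg K[{fmonom 'I_n.-1}]}) :
  free_act (c *: a + b) = c *: free_act a + free_act b.
Proof.
pose D := (msupp a `|` msupp b)%fset.
have sa : (msupp a `<=` D)%fset by exact: fsubsetUl.
have sb : (msupp b `<=` D)%fset by exact: fsubsetUr.
have sc : (msupp (c *: a + b) `<=` D)%fset.
  apply: fsubset_trans (msuppD_le _ _) _; apply: fsetUSS => //.
  exact: msuppZ_le.
rewrite (free_actEw sa) (free_actEw sb) (free_actEw sc) scaler_sumr -big_split.
by apply: eq_bigr => w _; rewrite mcoeffD mcoeffZ scalerDl scalerA.
Qed.

Fact free_actU w c : free_act (mkmalgU w c) = c *: word_act w.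
Proof. by rewrite (free_actEw msuppU_le) big_seq_fset1 mcoeffUU. Qed.

Fact free_act0 : free_act 0 = 0.
Proof. by rewrite /free_act msupp0 big_seq_fset0. Qed.

Fact free_actD a b : free_act (a + b) = free_act a + free_act b.
Proof. by rewrite -[a in LHS]scale1r free_actP scale1r. Qed.

Fact free_actZ c a : free_act (c *: a) = c *: free_act a.
Proof. by rewrite -[c *: a]addr0 free_actP free_act0 addr0. Qed.

Fact free_actB a b : free_act (a - b) = free_act a - free_act b.
Proof. by rewrite -scaleN1r addrC free_actP scaleN1r addrC. Qed.

Fact free_actM (a b : {malg K[{fmonom 'I_n.-1}]}) :
  free_act (a * b) = free_act a *m free_act b.
Proof.
rewrite malgME (big_morph free_act free_actD free_act0) mulmx_suml.
apply: eq_bigr => u _.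
rewrite (big_morph free_act free_actD free_act0) mulmx_sumr.
apply: eq_bigr => v _.
rewrite free_actU -scalemxAl -scalemxAr scalerA; congr (_ *: _).
by rewrite -word_act_cat; congr word_act; rewrite /mmul /mul /= fmmulE.
Qed.

Fact free_act1 : free_act 1 = 1%:M.
Proof. by rewrite free_actU fm1 scale1r. Qed.

Fact free_act_gen i : free_act (fgen K i) = p i.
Proof. by rewrite free_actU fmuE scale1r /= mulmx1. Qed.

Fact free_act_ideal a : a \in @hecke_ideal K n -> free_act a = 0.
Proof.
move=> /hecke_idealP; elim=> [|x y _ hx _ hy|x s y Ss].
- exact: free_act0.
- by rewrite free_actB hx hy subrr.
suff es : free_act s = 0 by rewrite 2!free_actM es mulmx0 mul0mx.
case: Ss => [i|i j ij|i j ij].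
- by rewrite free_actD free_actM free_act_gen ops_quad addNr.
- rewrite free_actB [X in X - _]free_actM [X in _ - X]free_actM.
  by rewrite 2!free_act_gen (ops_comm p ij) subrr.
rewrite free_actB [X in X - _]free_actM [X in _ - X]free_actM.
rewrite [X in X *m _ - _]free_actM [X in _ - X *m _]free_actM.
by rewrite 2!free_act_gen (ops_braid p ij) subrr.
Qed.

Fact free_act_pi a : free_act (hecke_repr (hecke_pi a)) = free_act a.
Proof.
apply/eqP; rewrite -subr_eq0 -free_actB; apply/eqP/free_act_ideal/hecke_piP.
exact: hecke_reprK.
Qed.

Definition ops_act (h : hecke K n) : 'M[K]_d := free_act (hecke_repr h).

Fact ops_act1 : ops_act 1 = 1%:M.
Proof. by rewrite /ops_act free_act_pi free_act1. Qed.

Fact ops_actM x y : ops_act (x * y) = ops_act x *m ops_act y.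
Proof. by rewrite /ops_act free_act_pi free_actM. Qed.

Fact ops_actP c x y : ops_act (c *: x + y) = c *: ops_act x + ops_act y.
Proof.
rewrite -[x in LHS]hecke_reprK -[y in LHS]hecke_reprK.
rewrite -[c *: _]hecke_piZ -hecke_piD.
by rewrite /ops_act free_act_pi free_actP.
Qed.

Definition mod_of_ops : fdmod K n := FDMod ops_act1 ops_actM ops_actP.

Lemma mod_of_opsE i : fd_act mod_of_ops (hecke_gen K i) = p i.
Proof. by rewrite /= /ops_act free_act_pi free_act_gen. Qed.

End ModuleOfOps.

Section SimpleModule.
Variables (K : fieldType) (n : nat) (al : composition n).

Definition simple_fun (i : 'I_n.-1) : 'M[K]_1 :=
  if i \in comp_Des al then - 1%:M else 0.

Fact simple_quad i : simple_fun i *m simple_fun i = - simple_fun i.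
Proof.
by rewrite /simple_fun; case: ifP; rewrite ?mulNmx ?mul1mx ?mul0mx ?oppr0.
Qed.

Fact simple_comm i j : simple_fun i *m simple_fun j = simple_fun j *m simple_fun i.
Proof.
by rewrite /simple_fun; do 2![case: ifP => _];
   rewrite ?(mulNmx, mulmxN, mul1mx, mulmx1, mul0mx, mulmx0, oppr0).
Qed.

Fact simple_braid i j :
  simple_fun i *m simple_fun j *m simple_fun i
  = simple_fun j *m simple_fun i *m simple_fun j.
Proof.
by rewrite /simple_fun; do 2![case: ifP => _];
   rewrite ?(mulNmx, mulmxN, mul1mx, mulmx1, mul0mx, mulmx0, oppr0).
Qed.

Definition simple_ops : hecke_ops K n 1 :=
  HeckeOps simple_quad (fun i j _ => simple_comm i j) (fun i j _ => simple_braid i j).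

Definition simple_mod : fdmod K n := mod_of_ops simple_ops.

End SimpleModule.

Definition short_exact (K : fieldType) (n : nat) (L M N : fdmod K n) : Prop :=
  exists (f : {linear fdvec L -> fdvec M}) (g : {linear fdvec M -> fdvec N}),
    [/\ injective f, (forall z, exists y, g y = z) &
        forall y, g y = 0 <-> exists x, f x = y].

Inductive subgroup_gen (V : zmodType) (S : V -> Prop) : V -> Prop :=
| SubgroupGen0 : subgroup_gen S 0
| SubgroupGen1 x : S x -> subgroup_gen S x
| SubgroupGenB x y : subgroup_gen S x -> subgroup_gen S y -> subgroup_gen S (x - y).

Section Grothendieck.
Variables (K : fieldType) (n : nat).

(* The free abelian group on finite-dimensional modules; isomorphic modules   *)
(* are identified below by the sequences 0 -> L -> M -> 0 -> 0.               *)
Definition free_mods : Type := {malg int[fdmod K n]}.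
HB.instance Definition _ := GRing.Zmodule.on free_mods.

Definition mod_gen (M : fdmod K n) : free_mods := mkmalgU M 1.

Inductive exact_rel : free_mods -> Prop :=
| ExactRel L M N : short_exact L M N ->
    exact_rel (mod_gen M - (mod_gen L + mod_gen N)).

Definition exact_sub : {pred free_mods} := fun x => `[< subgroup_gen exact_rel x >].

Lemma exact_subP x : reflect (subgroup_gen exact_rel x) (x \in exact_sub).
Proof. exact: asboolP. Qed.

Fact exact_sub_closed : zmod_closed exact_sub.
Proof.
split=> [|x y /exact_subP Sx /exact_subP Sy]; apply/exact_subP.
  exact: SubgroupGen0.
exact: SubgroupGenB.
Qed.
HB.instance Definition _ :=
  GRing.isZmodClosed.Build free_mods exact_sub exact_sub_closed.

Definition G0 : Type := Quotient.quot exact_sub.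
HB.instance Definition _ := GRing.Zmodule.on G0.

Definition G0_class (M : fdmod K n) : G0 := \pi_(Quotient.quot exact_sub) (mod_gen M).

Lemma G0_exact L M N : short_exact L M N -> G0_class M = G0_class L + G0_class N.
Proof.
move=> ses; rewrite /G0_class -[RHS]raddfD; apply/eqP.
rewrite -Quotient.idealrBE; apply/exact_subP/SubgroupGen1.
exact: ExactRel.
Qed.

End Grothendieck.

Section DirectSum.
Variable G : nat -> zmodType.

Definition dprod : Type := forall n, G n.
HB.instance Definition _ := Choice.on dprod.

Definition dprod_zero : dprod := fun=> 0.
Definition dprod_opp (f : dprod) : dprod := fun n => - f n.
Definition dprod_add (f g : dprod) : dprod := fun n => f n + g n.

Fact dprod_addA : associative dprod_add.
Proof. by move=> f g h; apply: functional_extensionality_dep => n; exact: addrA. Qed.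
Fact dprod_addC : commutative dprod_add.
Proof. by move=> f g; apply: functional_extensionality_dep => n; exact: addrC. Qed.
Fact dprod_add0 : left_id dprod_zero dprod_add.
Proof. by move=> f; apply: functional_extensionality_dep => n; exact: add0r. Qed.
Fact dprod_addN : left_inverse dprod_zero dprod_opp dprod_add.
Proof. by move=> f; apply: functional_extensionality_dep => n; exact: addNr. Qed.

HB.instance Definition _ :=
  GRing.isZmodule.Build dprod dprod_addA dprod_addC dprod_add0 dprod_addN.

Definition finsupp_pred : {pred dprod} :=
  fun f => `[< exists N, forall n, (N <= n)%N -> f n = 0 >].

Lemma finsupp_predP f :
  reflect (exists N, forall n, (N <= n)%N -> f n = 0) (f \in finsupp_pred).
Proof. exact: asboolP. Qed.

Fact finsupp_closed : zmod_closed finsupp_pred.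
Proof.
split=> [|f g /finsupp_predP[N fN] /finsupp_predP[P gP]]; apply/finsupp_predP.
  by exists 0%N.
exists (maxn N P) => n; rewrite geq_max => /andP[/fN f0 /gP g0].
by rewrite /GRing.add /= /dprod_add f0 /GRing.opp /= /dprod_opp g0 oppr0 addr0.
Qed.
HB.instance Definition _ := GRing.isZmodClosed.Build dprod finsupp_pred finsupp_closed.

Record dsum := DSum { dsum_val : dprod; _ : dsum_val \in finsupp_pred }.
HB.instance Definition _ := [isSub for dsum_val].
HB.instance Definition _ := [Choice of dsum by <:].
HB.instance Definition _ := [SubChoice_isSubZmodule of dsum by <:].

(* The element of the direct sum whose only nonzero component is x, at n.     *)
Fact dsum_inj_proof n (x : G n) :
  (dfwith (fun k => 0 : G k) x : dprod) \in finsupp_pred.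
Proof.
apply/finsupp_predP; exists n.+1 => k nk; rewrite dfwith_out //.
by rewrite ltn_eqF.
Qed.
Definition dsum_inj n (x : G n) : dsum := DSum (dsum_inj_proof x).

End DirectSum.

Record diagram (n : nat) := Diagram {
  boxes : {fset int * int};
  reading : rel boxes;
  card_boxes : #|` boxes| = n;
  reading_total : total reading;
  reading_trans : transitive reading;
  reading_anti : antisymmetric reading }.

Section Fillings.
Variables (n : nat) (D : diagram n).

Definition filling := {ffun boxes D -> 'I_n}.
Implicit Types (T U : filling) (i j : 'I_n.-1) (S : {set filling}) (r s : nat).

Definition StdFill : {set filling} := [set T : filling | `[< bijective T >]].

Definition rw T : seq 'I_n :=
  [seq T b | b <- sort (@reading n D) (enum {: boxes D})].

Definition swap i T : filling := [ffun b => tperm (idx i) (idxS i) (T b)].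

Definition tab_Des T : {set 'I_n.-1} :=
  [set i | (index (idxS i) (rw T) < index (idx i) (rw T))%N].

Definition attacking S T i : bool := (i \notin tab_Des T) && (swap i T \notin S).

(* T has an ascent in positions (r,s), namely i = rw(T)_r.                    *)
Definition ascent_at T i r s : bool :=
  [&& (r < s)%N, onth (rw T) r == Some (idx i) & onth (rw T) s == Some (idxS i)].

Definition ascent_compatible S : Prop :=
  forall T U r s i j, T \in S -> U \in S -> ascent_at T i r s ->
    ascent_at U j r s -> attacking S T i = attacking S U j.

Local Notation pos T k := (index k (rw T)).

Lemma mem_rw T k : T \in StdFill -> k \in rw T.
Proof.
rewrite inE => /asboolP[g _ gK].
by apply/mapP; exists (g k); rewrite ?mem_sort ?mem_enum ?gK.
Qed.

Fact pos_swap i T k : pos (swap i T) k = pos T (tperm (idx i) (idxS i) k).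
Proof.
have -> : rw (swap i T) = map (tperm (idx i) (idxS i)) (rw T).
  by rewrite /rw -map_comp; apply: eq_map => b /=; rewrite ffunE.
by rewrite -{1}[k](tpermK (idx i) (idxS i)) index_map //; exact: perm_inj.
Qed.

Fact idx_neq i : idx i != idxS i.
Proof. by rewrite -val_eqE /= ltn_eqF. Qed.

Fact pos_inj T k l : T \in StdFill -> pos T k = pos T l -> k = l.
Proof.
move=> sT e; rewrite -(nth_index k (mem_rw k sT)) e.
by rewrite nth_index // mem_rw.
Qed.

Fact onth_pos T k : T \in StdFill -> onth (rw T) (pos T k) = Some k.
Proof.
move=> sT; have kT := mem_rw k sT.
by rewrite onthE (nth_map k) ?index_mem // nth_index.
Qed.

End Fillings.

Section TableauModule.
Variables (K : fieldType) (n : nat) (D : diagram n) (S : {set filling D}).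
Hypotheses (S_std : S \subset StdFill D) (S_compat : ascent_compatible S).
Implicit Types (T U : filling D) (i j : 'I_n.-1) (r s : nat).

Local Notation pos T k := (index k (rw T)).

Definition tab := {T : filling D | T \in S}.

(* The column vector of T; 0 if T is not in StdTab(D).                        *)
Definition tab_vec T : 'cV[K]_#|{: tab}| :=
  if insub T is Some U then delta_mx (enum_rank (U : tab)) 0 else 0.

Definition tab_act i T : 'cV[K]_#|{: tab}| :=
  if i \in tab_Des T then - tab_vec T
  else if attacking S T i then 0 else tab_vec (swap i T).

Definition tab_fun i : 'M[K]_#|{: tab}| :=
  \matrix_(a, b) tab_act i (val (enum_val b)) a 0.

Lemma tab_funE i T : T \in S -> tab_fun i *m tab_vec T = tab_act i T.
Proof.
move=> ST; rewrite /tab_vec insubT -colE; apply/colP=> a.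
by rewrite !mxE enum_rankK.
Qed.

Fact tab_ext (A B : 'M[K]_#|{: tab}|) :
  (forall T, T \in S -> A *m tab_vec T = B *m tab_vec T) -> A = B.
Proof.
move=> AB; apply/matrixP => a b.
have := AB _ (valP (enum_val b)); rewrite /tab_vec valK enum_valK -!colE.
by move/colP/(_ a); rewrite !mxE.
Qed.

Fact S_StdFill T : T \in S -> T \in StdFill D.
Proof. exact: (fintype.subsetP S_std). Qed.

Definition nonatt r s : bool :=
  [exists T : filling D, exists i, [&& T \in S, ascent_at T i r s & swap i T \in S]].

Fact pos_neq T k l : T \in S -> k != l -> pos T k != pos T l.
Proof. by move=> /S_StdFill sT; apply: contraNneq => e; rewrite (pos_inj sT e). Qed.

Fact ascent_atE T i : T \in S ->
  ascent_at T i (pos T (idx i)) (pos T (idxS i)) = (i \notin tab_Des T).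
Proof.
move=> ST; have sT := S_StdFill ST.
rewrite /ascent_at !onth_pos // !eqxx !andbT inE -leqNgt.
by rewrite ltn_neqAle pos_neq ?idx_neq.
Qed.

Fact nonattE T i : T \in S -> i \notin tab_Des T ->
  (swap i T \in S) = nonatt (pos T (idx i)) (pos T (idxS i)).
Proof.
move=> ST asc; have aT := ascent_atE i ST; rewrite asc in aT.
apply/idP/existsP => [sT|[U /existsP[j /and3P[SU aU sU]]]].
  by exists T; apply/existsP; exists i; rewrite ST aT.
have := S_compat ST SU aT aU; rewrite /attacking asc sU andbF /=.
by move/negbFE.
Qed.

Fact actE T i : T \in S -> tab_fun i *m tab_vec T =
  if (pos T (idxS i) < pos T (idx i))%N then - tab_vec T
  else if nonatt (pos T (idx i)) (pos T (idxS i)) then tab_vec (swap i T) else 0.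
Proof.
move=> ST; rewrite tab_funE // /tab_act inE.
case: ltnP => // asc.
have asc' : i \notin tab_Des T by rewrite inE -leqNgt.
by rewrite /attacking asc' nonattE //=; case: nonatt.
Qed.

Fact swapS T i : T \in S -> (pos T (idxS i) < pos T (idx i))%N = false ->
  nonatt (pos T (idx i)) (pos T (idxS i)) -> swap i T \in S.
Proof. by move=> ST asc; rewrite nonattE // inE asc. Qed.

Fact pos_swapL i T : pos (swap i T) (idx i) = pos T (idxS i).
Proof. by rewrite pos_swap tpermL. Qed.
Fact pos_swapR i T : pos (swap i T) (idxS i) = pos T (idx i).
Proof. by rewrite pos_swap tpermR. Qed.
Fact pos_swapD i T k : idx i != k -> idxS i != k -> pos (swap i T) k = pos T k.
Proof. by move=> *; rewrite pos_swap tpermD. Qed.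

Fact ltF (a b : nat) : (a < b)%N -> (b < a)%N = false.
Proof. by move=> ab; rewrite ltnNge ltnW. Qed.

Fact tab_quad i : tab_fun i *m tab_fun i = - tab_fun i.
Proof.
apply: tab_ext => T ST; rewrite mulNmx -mulmxA actE //.
have neq := pos_neq ST (idx_neq i).
case: ltngtP neq => // h _.
  by rewrite mulmxN actE // h opprK.
case: (boolP (nonatt _ _)) => na; last by rewrite mulmx0 oppr0.
have ST' : swap i T \in S by exact: (swapS ST (ltF h) na).
by rewrite actE // pos_swapL pos_swapR h.
Qed.

Fact swap_comm i j T : idx i != idx j -> idx i != idxS j -> idxS i != idx j ->
  idxS i != idxS j -> swap i (swap j T) = swap j (swap i T).
Proof.
move=> n1 n2 n3 n4; apply/ffunP => b; rewrite !ffunE.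
have C : (tperm (idx j) (idxS j) * tperm (idx i) (idxS i)
   = tperm (idx i) (idxS i) * tperm (idx j) (idxS j))%g.
  by rewrite conjgC tpermJ !tpermD // eq_sym.
by rewrite -!permM C.
Qed.

Fact tab_comm i j : (i.+1 < j)%N || (j.+1 < i)%N ->
  tab_fun i *m tab_fun j = tab_fun j *m tab_fun i.
Proof.
move=> ij; apply: tab_ext => T ST; rewrite -!mulmxA.
have n1 : idx i != idx j by rewrite -val_eqE /=; apply/eqP; lia.
have n2 : idx i != idxS j by rewrite -val_eqE /=; apply/eqP; lia.
have n3 : idxS i != idx j by rewrite -val_eqE /=; apply/eqP; lia.
have n4 : idxS i != idxS j by rewrite -val_eqE /=; apply/eqP; lia.
have E1 U : (pos (swap j U) (idx i) = pos U (idx i)) *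
            (pos (swap j U) (idxS i) = pos U (idxS i)).
  by rewrite !pos_swapD // eq_sym.
have E2 U : (pos (swap i U) (idx j) = pos U (idx j)) *
            (pos (swap i U) (idxS j) = pos U (idxS j)).
  by rewrite !pos_swapD // eq_sym.
have swC := swap_comm T n1 n2 n3 n4.
rewrite [in LHS]actE // [in RHS]actE //.
case: (boolP (pos T (idxS j) < pos T (idx j))%N) => dj;
case: (boolP (pos T (idxS i) < pos T (idx i))%N) => di.
- by rewrite !mulmxN !actE // dj di.
- rewrite mulmxN actE // (negPf di); case: ifP => na; rewrite ?mulmx0 ?oppr0 //.
  by rewrite actE ?E2 ?dj //; exact: (swapS ST (negPf di) na).
- rewrite mulmxN actE // (negPf dj); case: ifP => na; rewrite ?mulmx0 ?oppr0 //.
  by rewrite actE ?E1 ?di //; exact: (swapS ST (negPf dj) na).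
have Sj : nonatt (pos T (idx j)) (pos T (idxS j)) -> swap j T \in S.
  exact: (swapS ST (negPf dj)).
have Si : nonatt (pos T (idx i)) (pos T (idxS i)) -> swap i T \in S.
  exact: (swapS ST (negPf di)).
case: ifP => naj; case: ifP => nai; rewrite ?mulmx0 //.
- by rewrite !actE ?E1 ?E2 ?(negPf di) ?(negPf dj) ?nai ?naj ?swC //; auto.
- by rewrite actE ?E1 ?(negPf di) ?nai //; auto.
by rewrite actE ?E2 ?(negPf dj) ?naj //; auto.
Qed.

Fact swap_braid i j T : j = i.+1 :> nat ->
  swap i (swap j (swap i T)) = swap j (swap i (swap j T)).
Proof.
move=> ij; have e : idx j = idxS i by apply: val_inj.
have n1 := idx_neq i; have n2 := idx_neq j; rewrite e in n2.
have n3 : idx i != idxS j by rewrite -val_eqE /= ij; apply/eqP; lia.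
apply/ffunP => b; rewrite !ffunE e -!permM; congr (fun_of_perm _ _).
have J (s t : {perm 'I_n}) : s = s^-1%g -> (s * t * s = t ^ s)%g.
  by move=> es; rewrite conjgE -es mulgA.
rewrite !mulgA !J ?tpermV // !tpermJ tpermL tpermR !tpermD // eq_sym //.
Qed.

Fact tab_braid i j : j = i.+1 :> nat ->
  tab_fun i *m tab_fun j *m tab_fun i = tab_fun j *m tab_fun i *m tab_fun j.
Proof.
move=> ij; apply: tab_ext => T ST; rewrite -!mulmxA.
have e : idx j = idxS i by apply: val_inj.
have n1 := idx_neq i; have n2 := idx_neq j; rewrite e in n2.
have n3 : idx i != idxS j by rewrite -val_eqE /= ij; apply/eqP; lia.
have Ai U : U \in S -> tab_fun i *m tab_vec U =
    if (pos U (idxS i) < pos U (idx i))%N then - tab_vec U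
    else if nonatt (pos U (idx i)) (pos U (idxS i)) then tab_vec (swap i U) else 0.
  exact: actE.
have Aj U : U \in S -> tab_fun j *m tab_vec U =
    if (pos U (idxS j) < pos U (idxS i))%N then - tab_vec U
    else if nonatt (pos U (idxS i)) (pos U (idxS j)) then tab_vec (swap j U) else 0.
  by rewrite -e; exact: actE.
have Si U : U \in S -> (pos U (idxS i) < pos U (idx i))%N = false ->
    nonatt (pos U (idx i)) (pos U (idxS i)) -> swap i U \in S by exact: swapS.
have Sj U : U \in S -> (pos U (idxS j) < pos U (idxS i))%N = false ->
    nonatt (pos U (idxS i)) (pos U (idxS j)) -> swap j U \in S.
  by rewrite -e; exact: swapS.
have Ei U : (pos (swap i U) (idx i) = pos U (idxS i)) *
  (pos (swap i U) (idxS i) = pos U (idx i)) *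
  (pos (swap i U) (idxS j) = pos U (idxS j)).
  by rewrite pos_swapL pos_swapR pos_swapD.
have Ej U : (pos (swap j U) (idx i) = pos U (idx i)) *
  (pos (swap j U) (idxS i) = pos U (idxS j)) *
  (pos (swap j U) (idxS j) = pos U (idxS i)).
  have L := pos_swapL j U; have R := pos_swapR j U; rewrite e in L R.
  by rewrite L R pos_swapD // eq_sym ?e.
have swB := swap_braid T ij.
have nab := pos_neq ST n1; have nbc := pos_neq ST n2; have nac := pos_neq ST n3.
have order (k l : 'I_n) : pos T k != pos T l ->
  ((pos T k < pos T l)%N = true /\ (pos T l < pos T k)%N = false) \/
  ((pos T k < pos T l)%N = false /\ (pos T l < pos T k)%N = true).
  by case: ltngtP => // _ _; [left | right].
have [[ab ba]|[ab ba]] := order _ _ nab;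
have [[bc cb]|[bc cb]] := order _ _ nbc;
have [[ac ca]|[ac ca]] := order _ _ nac; try (exfalso; lia);
(let simp := (rewrite ?(Ei, Ej) ?ab ?ba ?bc ?cb ?ac ?ca ?mulmxN ?mulmx0 ?opprK ?oppr0) in
 let mem := (do ?[exact: ST | apply: Si | apply: Sj]; simp; done) in
 repeat (simp; match goal with
 | H : nonatt ?p ?q = _ |- context [nonatt ?p ?q] => rewrite H
 | |- context [if nonatt ?p ?q then _ else _] =>
   let H := fresh "na" in case H : (nonatt p q)
 | |- context [tab_fun i *m tab_vec ?U] =>
   let H := fresh in
   (have H : U \in S by mem); rewrite (Ai U H); clear H
 | |- context [tab_fun j *m tab_vec ?U] =>
   let H := fresh in
   (have H : U \in S by mem); rewrite (Aj U H); clear H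
 end); simp; rewrite ?swB //).
Qed.

Definition tab_ops : hecke_ops K n #|{: tab}| :=
  HeckeOps tab_quad tab_comm tab_braid.

Definition tab_mod : fdmod K n := mod_of_ops tab_ops.

Lemma tab_modE i T : T \in S ->
  fd_act tab_mod (hecke_gen K i) *m tab_vec T = tab_act i T.
Proof. by move=> ST; rewrite mod_of_opsE tab_funE. Qed.

End TableauModule.

(* Main.v *)
From HB Require Import structures.
Require Import Defs.
From mathcomp Require Import all_boot all_order all_algebra.
From mathcomp Require Import perm zify boolp.
From mathcomp Require Import reals complex.

(* Each nonattacking ascent move lowers [\sum_k k * pos k], where [pos k] is  *)
(* the position of the entry [k] in the reading word.  So if [T0] maximizes   *)
(* this weight on [S], no other tableau of [S] reaches [T0]: the tableaux     *)
(* other than [T0] span a submodule with quotient the simple module of        *)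
(* [Des T0].  Moreover [S :\ T0] is again ascent-compatible and that          *)
(* submodule is its tableau module, so one concludes by induction on [#|S|].  *)

Set Implicit Arguments.
Unset Strict Implicit.
Unset Printing Implicit Defensive.

Import GRing.Theory.
Local Open Scope ring_scope.

(** Since [ch] is additive and sends the class of each simple module to the fundamental function, it
    suffices to write the class of the tableau module in the Grothendieck group as a sum of simple
    classes ([G0_class_tab]). Each induction step is an exact sequence with the module of [S :\ T0]
    as sub and a simple module as quotient ([G0_class_tab_setD1]). It is given by explicit matrices
    that commute with the generators and split over [K]. *)

Section Intertwining.
Variables (K : fieldType) (n d e : nat).
Variables (p : hecke_ops K n d) (q : hecke_ops K n e) (A : 'M[K]_(e, d)).
Hypothesis pqA : forall i, A *m p i = q i *m A.

(** An element of the Hecke algebra acts by a linear combination of words in the generators, so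
    commuting with the generators is enough. *)
Lemma ops_act_intertwine h : A *m ops_act p h = ops_act q h *m A.
Proof.
have word w : A *m word_act p w = word_act q w *m A.
  elim: w => [|i w IH] /=; first by rewrite mulmx1 mul1mx.
  by rewrite mulmxA pqA -!mulmxA IH.
rewrite mulmx_sumr mulmx_suml; apply: eq_bigr => w _.
by rewrite -scalemxAr -scalemxAl word.
Qed.

(* The hypothesis is an argument so that the linear structure below can be    *)
(* inferred from the function.                                                *)
Definition intertwiner (_ : forall i, A *m p i = q i *m A)
    (v : fdvec (mod_of_ops p)) : fdvec (mod_of_ops q) :=
  A *m (v : 'cV_d).

Fact intertwiner_linear : linear (intertwiner pqA).
Proof.
move=> h u v; rewrite /intertwiner [LHS]mulmxDr; congr (_ + _).
by rewrite [LHS]mulmxA [X in X *m _]ops_act_intertwine -mulmxA.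
Qed.

HB.instance Definition _ :=
  GRing.isLinear.Build (hecke K n) (fdvec (mod_of_ops p))
    (fdvec (mod_of_ops q)) _ (intertwiner pqA) intertwiner_linear.

End Intertwining.

(** The splitting [A'], [B'] is one of vector spaces only: it need not commute with the operators.
    Multiplying the last identity by [B] on the left and [A] on the right gives [BA + BA = BA],
    hence [BA = 0]. *)
Lemma short_exact_split (K : fieldType) (n a b c : nat)
  (p : hecke_ops K n a) (q : hecke_ops K n b) (r : hecke_ops K n c)
  (A : 'M[K]_(b, a)) (A' : 'M[K]_(a, b)) (B : 'M[K]_(c, b)) (B' : 'M[K]_(b, c)) :
  (forall i, A *m p i = q i *m A) -> (forall i, B *m q i = r i *m B) ->
  A' *m A = 1%:M -> B *m B' = 1%:M -> A *m A' + B' *m B = 1%:M ->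
  short_exact (mod_of_ops p) (mod_of_ops q) (mod_of_ops r).
Proof.
move=> pqA qrB A'A BB' AB.
have BA : B *m A = 0.
  have: B *m (A *m A' + B' *m B) *m A = B *m A by rewrite AB mulmx1.
  rewrite mulmxDr mulmxDl [in X in _ + X]mulmxA BB' mul1mx -!mulmxA A'A mulmx1.
  by move/eqP; rewrite -subr_eq0 addrK => /eqP.
exists (intertwiner pqA : {linear _ -> _}), (intertwiner qrB : {linear _ -> _}).
split=> [u v|z|y].
- move=> /(congr1 (mulmx A')); rewrite /= /intertwiner.
  by rewrite !mulmxA A'A !mul1mx.
- by exists (B' *m (z : 'cV_c)); rewrite /= /intertwiner mulmxA BB' mul1mx.
split=> [By|[x <-]]; last by rewrite /= /intertwiner mulmxA BA mul0mx.
exists (A' *m (y : 'cV_b)); rewrite /= /intertwiner mulmxA.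
rewrite -[RHS](mul1mx (y : 'cV_b)) -AB mulmxDl -[in RHS](mulmxA B').
by move: By; rewrite /= /intertwiner => ->; rewrite mulmx0 addr0.
Qed.

(** The zero module is an extension of itself by itself, so its class [x] satisfies [x = x + x]. *)
Lemma G0_class_dim0 (K : fieldType) (n : nat) (p : hecke_ops K n 0) :
  G0_class (mod_of_ops p) = 0.
Proof.
have /G0_exact/eqP : short_exact (mod_of_ops p) (mod_of_ops p) (mod_of_ops p).
  apply: (@short_exact_split _ _ _ _ _ p p p 0 0 0 0) => *;
  by apply/matrixP => -[].
by rewrite -subr_eq0 opprD addNKr oppr_eq0 => /eqP.
Qed.

Section Weight.
Variables (n : nat) (D : diagram n).
Implicit Types (T : filling D) (S : {set filling D}).

Definition rw_weight T : nat := \sum_(k < n) k * index k (rw T).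

(** Only two terms change: with [u < v] the positions of the two entries, [i * u + i.+1 * v] becomes
    [i * v + i.+1 * u], a drop of [v - u]. *)
Lemma rw_weight_swap i T : T \in StdFill D -> i \notin tab_Des T ->
  (rw_weight (swap i T) < rw_weight T)%N.
Proof.
move=> sT; rewrite inE -leqNgt => asc.
have {}asc : (index (idx i) (rw T) < index (idxS i) (rw T))%N.
  rewrite ltn_neqAle asc andbT; apply: contraNneq (idx_neq i).
  by move/(pos_inj sT) ->.
rewrite /rw_weight.
have split2 (g : 'I_n -> nat) : (\sum_(k < n) k * g k = i * g (idx i) +
    (i.+1 * g (idxS i) + \sum_(k | (k != idx i) && (k != idxS i)) k * g k))%N.
  by rewrite (bigD1 (idx i)) //= (bigD1 (idxS i)) //= eq_sym idx_neq.
rewrite !split2 !pos_swap tpermL tpermR.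
rewrite (eq_bigr (fun k : 'I_n => k * index k (rw T))%N) => [|k /andP[ki kS]].
  move: (bigop _ _ _) => r.
  by move: (index (idx i) _) (index (idxS i) _) asc => u v; nia.
by rewrite pos_swap tpermD // eq_sym.
Qed.

Variables (S : {set filling D}) (T0 : filling D).
Hypothesis unreach : forall T i, T \in S -> i \notin tab_Des T -> swap i T != T0.

(** An ascent move never lands on [T0], so it stays in [S :\ T0] exactly when it stays in [S]. *)
Lemma attacking_setD1 T i : T \in S -> attacking (S :\ T0) T i = attacking S T i.
Proof.
move=> ST; rewrite /attacking !inE negb_and negbK.
case: (boolP (index _ _ < _)%N) => //= asc.
by rewrite (negPf (unreach ST _)) // inE.
Qed.

Lemma ascent_compatible_setD1 :
  ascent_compatible S -> ascent_compatible (S :\ T0).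
Proof.
move=> Sc T U r s i j /setD1P[_ ST] /setD1P[_ SU] aT aU.
by rewrite !attacking_setD1 //; exact: Sc aT aU.
Qed.

End Weight.

Section Transfer.
Variables (K : fieldType) (n : nat) (D : diagram n).
Implicit Types (T : filling D) (S U : {set filling D}).

Lemma tab_vec_out S T : T \notin S -> tab_vec K S T = 0.
Proof. by move=> ST; rewrite /tab_vec insubN. Qed.

Definition tab_lin S d (f : filling D -> 'cV[K]_d) : 'M[K]_(d, #|{: tab S}|) :=
  \matrix_(a, b) f (val (enum_val b)) a 0.

Lemma tab_linE S d (f : filling D -> 'cV[K]_d) T :
  T \in S -> tab_lin S f *m tab_vec K S T = f T.
Proof.
move=> ST; rewrite /tab_vec insubT -colE; apply/colP=> a.
by rewrite !mxE enum_rankK.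
Qed.

Lemma tab_mx_ext S d (A B : 'M[K]_(d, #|{: tab S}|)) :
  (forall T, T \in S -> A *m tab_vec K S T = B *m tab_vec K S T) -> A = B.
Proof.
move=> AB; apply/matrixP => a b.
have := AB _ (valP (enum_val b)); rewrite /tab_vec valK enum_valK -!colE.
by move/colP/(_ a); rewrite !mxE.
Qed.

Variables (S : {set filling D}) (T0 : filling D).
Hypotheses (S_std : S \subset StdFill D) (S_compat : ascent_compatible S).
Hypotheses (U_std : S :\ T0 \subset StdFill D).
Hypotheses (U_compat : ascent_compatible (S :\ T0)).
Hypotheses (ST0 : T0 \in S).
Hypothesis unreach : forall T i, T \in S -> i \notin tab_Des T -> swap i T != T0.

Lemma G0_class_tab_setD1 :
  G0_class (tab_mod K S_std S_compat) =
  G0_class (tab_mod K U_std U_compat)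
  + G0_class (simple_mod K (comp_of_set (tab_Des T0))).
Proof.
pose U := S :\ T0.
have US T : T \in U -> T \in S by case/setD1P.
(* [A] is the inclusion of the span of [U], [A'] the projection that kills [T0], [B] reads off the
   coefficient of [T0], and [B'] is the basis vector of [T0]. *)
pose A := tab_lin U (tab_vec K S); pose A' := tab_lin S (tab_vec K U).
pose B : 'M[K]_(1, #|{: tab S}|) := tab_lin S (fun T => (T == T0)%:R%:M).
pose B' := tab_vec K S T0.
have BE T : T \in S -> B *m tab_vec K S T = (T == T0)%:R%:M.
  exact: (tab_linE (fun T => (T == T0)%:R%:M)).
have T0U : T0 \notin U by rewrite !inE eqxx.
apply/G0_exact/(@short_exact_split _ _ _ _ _ _ _ _ A A' B B') => [i|i|||].
- apply: tab_mx_ext => T UT; have ST := US T UT.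
  rewrite -!mulmxA tab_funE // tab_linE // tab_funE // /tab_act attacking_setD1 //.
  case: ifP => Des; first by rewrite mulmxN tab_linE.
  case: ifP => [_|/negbT att]; first by rewrite mulmx0.
  rewrite tab_linE // !inE unreach ?Des //=.
  by move: att; rewrite /attacking Des /= negbK.
- apply: tab_mx_ext => T ST.
  rewrite -!mulmxA tab_funE // BE // /= /simple_fun comp_of_setK /tab_act.
  case: ifP => Des.
    rewrite mulmxN BE //; case: eqVneq Des => [->->|_ _].
      by rewrite mulNmx mul1mx.
    by rewrite raddf0 mulmx0 oppr0.
  (* At an ascent both sides vanish: the move, if nonattacking, gives a tableau other than [T0], and
     the simple module of [T0] has eigenvalue 0 there. *)
  transitivity (0 : 'M[K]_1).
    case: ifP => [_|/negbT]; first by rewrite mulmx0.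
    rewrite /attacking Des /= negbK => sT.
    by rewrite BE // (negPf (unreach ST _)) ?Des // raddf0.
  case: eqVneq Des => [->->|_ _]; first by rewrite mul0mx.
  by rewrite raddf0 mulmx0.
- apply: tab_mx_ext => T UT.
  by rewrite -mulmxA mul1mx !tab_linE ?US.
- by rewrite BE // eqxx.
apply: tab_mx_ext => T ST.
rewrite mulmxDl -!mulmxA BE // tab_linE // mul1mx.
case: (eqVneq T T0) => [->|TT0].
  by rewrite tab_vec_out // mulmx0 mulmx1 add0r.
by rewrite tab_linE ?raddf0 ?mulmx0 ?addr0 // !inE TT0.
Qed.

End Transfer.

Lemma G0_class_tab (K : fieldType) (n : nat) (D : diagram n)
  (S : {set filling D}) (S_std : S \subset StdFill D)
  (S_compat : ascent_compatible S) :
  G0_class (tab_mod K S_std S_compat) =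
  \sum_(T in S) G0_class (simple_mod K (comp_of_set (tab_Des T))).
Proof.
have [m] := ubnP #|S|; elim: m S S_std S_compat => // m IH S S_std S_compat Sm.
have [S0|[T1 ST1]] := set_0Vmem S.
  have d0 : #|{: tab S}| = 0%N.
    by rewrite card_sig; apply: eq_card0 => T; rewrite !inE S0 inE.
  rewrite [RHS]big_pred0 => [|T]; last by rewrite S0 inE.
  (* The operators are generalized so that their dimension can be replaced by 0. *)
  rewrite /tab_mod; move: (tab_ops _ _ _); rewrite d0; exact: G0_class_dim0.
case: (arg_maxnP (@rw_weight n D) ST1) => T0 T0S T0max.
have {T0S} ST0 : T0 \in S by [].
have unreach T i : T \in S -> i \notin tab_Des T -> swap i T != T0.
  move=> ST asc; apply: contraTneq (T0max T ST) => <-; rewrite -ltnNge.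
  exact: rw_weight_swap (fintype.subsetP S_std T ST) asc.
have U_std : S :\ T0 \subset StdFill D := fintype.subset_trans (subD1set S T0) S_std.
have U_compat := ascent_compatible_setD1 unreach S_compat.
rewrite (G0_class_tab_setD1 K S_std S_compat U_std U_compat ST0 unreach).
rewrite IH ?(big_setD1 T0 ST0) /= 1?addrC //.
by move: Sm; rewrite (cardsD1 T0) ST0 ltnS.
Qed.

(** Needed to carry the sum of simple classes through [dsum_inj] before applying [ch]. *)
Lemma dsum_inj_is_additive (G : nat -> zmodType) (n : nat) :
  zmod_morphism (@dsum_inj G n).
Proof.
move=> x y; apply: val_inj; apply: functional_extensionality_dep => k.
transitivity (dsum_val (dsum_inj x) k - dsum_val (dsum_inj y) k) => //=.
case: (eqVneq n k) => [e|nk]; last by rewrite !dfwith_out // subrr.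
by case: _ / e; rewrite !dfwith_in.
Qed.

HB.instance Definition _ (G : nat -> zmodType) (n : nat) :=
  GRing.isZmodMorphism.Build (G n) (dsum G) (@dsum_inj G n)
    (@dsum_inj_is_additive G n).

Theorem theorem3p13 (R : realType)
  (ch : {additive dsum (fun n => G0 R[i] n) -> QSym})
  (ch_bij : bijective ch)
  (ch_simple : forall (n : nat) (al : composition n),
     ch (dsum_inj (G0_class (simple_mod R[i] al))) = QSymF al)
  (n : nat) (D : diagram n) (S : {set filling D})
  (S_neq0 : S != set0) (S_std : S \subset StdFill D)
  (S_compat : ascent_compatible S) :
  ch (dsum_inj (G0_class (tab_mod R[i] S_std S_compat)))
  = \sum_(T in S) QSymF (comp_of_set (tab_Des T)).
Proof.
rewrite G0_class_tab !raddf_sum; apply: eq_bigr => T _.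
exact: ch_simple.
Qed.
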